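(* Let $n \geq 1$ be an integer and let $r_1, \ldots, r_n$ be real numbers (not necessarily distinct). For $k = 1, \ldots, n$, let $r_{(k)}$ denote the $k$th smallest among $r_1, \ldots, r_n$, and let $\Im_k$ be the set of all $k$-element subsets of $N = \{1, \ldots, n\}$. Then for each $k = 1, \ldots, n$, $$r_{(k)} = \min_{I \in \Im_k} \; \max_{i \in I} \; r_i.$$
   Context: The numbers $r_1, \ldots, r_n$ are arranged in order of increase, and equal values are counted repeatedly (with multiplicity) in an arbitrary order, so that $r_{(1)} \leq r_{(2)} \leq \cdots \leq r_{(n)}$ is the sorted list of $r_1, \ldots, r_n$. *)

(* Defs.v *)
From mathcomp Require Import all_boot all_order all_algebra.
From mathcomp Require Import reals.

Set Implicit Arguments.
Unset Strict Implicit.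
Unset Printing Implicit Defensive.

Import Order.TTheory GRing.Theory Num.Theory.
Local Open Scope ring_scope.

(* The maximum (minimum) of [f] over a nonempty finite set [A]: the initial
   value of the fold is itself a value of [f] on [A], so it does not affect the
   result.  Both are 0 when [A] is empty. *)
Definition max_over (R : realType) (T : finType) (A : {set T}) (f : T -> R) : R :=
  \big[Num.max/head 0 [seq f x | x in A]]_(x in A) f x.

Definition min_over (R : realType) (T : finType) (A : {set T}) (f : T -> R) : R :=
  \big[Num.min/head 0 [seq f x | x in A]]_(x in A) f x.

(* The [k]-th smallest of the [r i], counted with multiplicity; [k] ranges over
   [1, ..., n], whereas [nth] and ['I_n] are numbered from 0. *)
Definition kth_smallest (R : realType) (n : nat) (r : 'I_n -> R) (k : nat) : R :=
  nth 0 (sort <=%R [seq r i | i : 'I_n]) k.-1.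

Definition k_subsets (n k : nat) : {set {set 'I_n}} := [set I : {set 'I_n} | #|I| == k].

(* Main.v *)
(* Let [e] list the indices so that [r] is nondecreasing along [e].  The first
   [k] entries of [e] form a [k]-subset with maximum at most [r_(k)]; conversely
   a [k]-subset cannot fit in the first [k - 1] entries of [e], so it contains
   an index [i] with [r_(k) <= r i]. *)
Require Import Defs.
From mathcomp Require Import all_boot all_order all_algebra.
From mathcomp Require Import reals.

Import Order.TTheory.
Local Open Scope ring_scope.

Section Extrema.
Variables (R : realType) (T : finType) (A : {set T}) (f : T -> R).

Lemma head_image_attained (x0 : T) :
  x0 \in A -> exists2 x, x \in A & head 0 [seq f x | x in A] = f x.
Proof.
rewrite -mem_enum /image_mem => x0A.
case E: (enum A) x0A => [|y s] //= _; exists y => //.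
by rewrite -mem_enum E mem_head.
Qed.

(** Being a value of [f] on [A] holds for the seed of the fold and is preserved by binary [max],
    which returns one of its arguments. *)
Lemma max_over_attained (x0 : T) :
  x0 \in A -> exists2 x, x \in A & max_over A f = f x.
Proof.
move=> x0A; rewrite /max_over.
apply: (big_ind (fun v => exists2 x, x \in A & v = f x)) => [|u v Hu Hv|x xA].
- exact: head_image_attained x0A.
- by rewrite /Order.max; case: ifP.
- by exists x.
Qed.

Lemma min_over_attained (x0 : T) :
  x0 \in A -> exists2 x, x \in A & min_over A f = f x.
Proof.
move=> x0A; rewrite /min_over.
apply: (big_ind (fun v => exists2 x, x \in A & v = f x)) => [|u v Hu Hv|x xA].
- exact: head_image_attained x0A.
- by rewrite /Order.min; case: ifP.
- by exists x.
Qed.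

Lemma le_max_over (x : T) : x \in A -> f x <= max_over A f.
Proof. by move=> xA; apply: le_bigmax_cond. Qed.

Lemma min_over_le (x : T) : x \in A -> min_over A f <= f x.
Proof. by move=> xA; apply: bigmin_le_cond. Qed.

End Extrema.

(** The order pulled back along [r] is a preorder: ties spoil antisymmetry, but transitivity and
    reflexivity suffice to pass from neighbours to any two positions. *)
Lemma sorted_by_le_nth (R : realType) (T : eqType) (r : T -> R) (x0 : T)
    (e : seq T) (i j : nat) :
  sorted (relpre r <=%R) e -> (i <= j < size e)%N ->
  r (nth x0 e i) <= r (nth x0 e j).
Proof.
move=> e_sorted /andP[le_ij lt_j].
have tr : transitive (relpre r <=%R) by move=> y x z; apply: le_trans.
have rf : reflexive (relpre r <=%R) by move=> x; apply: lexx.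
by apply: (sorted_leq_nth tr rf x0 e_sorted) => //; rewrite inE // (leq_ltn_trans le_ij).
Qed.

Theorem lemma1 (R : realType) (n : nat) (hn : (1 <= n)%N) (r : 'I_n -> R)
  (k : nat) (hk : (1 <= k <= n)%N) :
  kth_smallest r k = min_over (k_subsets n k) (fun I => max_over I r).
Proof.
(* From here on [k] is the zero-based position, one less than the rank in the statement. *)
case: k hk => [//|k] /= lt_kn.
(* Sort indices instead of values: the list stays free of duplicates even when [r] repeats values,
   so its prefixes can be counted as sets. *)
rewrite /kth_smallest /image_mem sort_map /=.
set e := sort _ _.
have i0 : 'I_n := Ordinal hn.
have size_e : size e = n by rewrite size_sort size_enum_ord.
have uniq_e : uniq e by rewrite sort_uniq enum_uniq.
have mem_e i : i \in e by rewrite mem_sort mem_enum.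
have e_sorted : sorted (relpre r <=%R) e by apply: sort_sorted => x y; apply: le_total.
rewrite (nth_map i0) ?size_e //.
pose J := [set i in take k.+1 e].
have J_k : J \in k_subsets n k.+1.
  rewrite inE cardsE (card_uniqP (take_uniq _ uniq_e)).
  by rewrite size_takel ?size_e.
apply/eqP; rewrite eq_le; apply/andP; split.
(* [J_k] shows that the family is nonempty, so some [I] attains the minimum. *)
- have [I + ->] := min_over_attained _ _ _ (fun I => max_over I r) _ J_k.
  rewrite inE => /eqP card_I.
  have [i iI i_late] : exists2 i, i \in I & i \notin take k e.
    apply/subsetPn/negP => /subset_leq_card.
    rewrite card_I (card_uniqP (take_uniq _ uniq_e)) size_takel ?size_e ?ltnn //.
    exact: ltnW.
  apply: le_trans (le_max_over _ _ _ r _ iI).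
  (* Lying outside [take k e] means having index at least [k] in [e]. *)
  rewrite -[in leRHS](nth_index i0 (mem_e i)); apply: sorted_by_le_nth => //.
  by rewrite index_mem mem_e andbT leqNgt -in_take.
- apply: le_trans (min_over_le _ _ _ (fun I => max_over I r) _ J_k) _.
  (* The first entry makes [J] nonempty, so its maximum is attained, at an index of position at most
     [k]. *)
  have e0J : nth i0 e 0 \in J by rewrite inE in_take // index_uniq // size_e.
  have [i + ->] := max_over_attained _ _ _ r _ e0J.
  rewrite inE in_take // => lt_ik.
  rewrite -[in leLHS](nth_index i0 (mem_e i)); apply: sorted_by_le_nth => //.
  by rewrite size_e lt_kn andbT.
Qed.
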